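(* Let $n\ge1$. The map $$\Psi_{2,n}\colon\operatorname{Ch}\bigl(\mathcal H_n^{(2)}\bigr)\longrightarrow\{\mathtt a,\mathtt b\}^n/{\sim_{3/2}},\qquad C\longmapsto[\,\mathtt b^{\,n-r(C)-t(C)}\,\mathtt a^{\,r(C)}\,\mathtt b^{\,t(C)}\,]_{\sim_{3/2}},$$ is a bijection.
   Context: $\mathcal H_n^{(2)}$ is the arrangement in $\mathbb R^2$ of the lines $H_i^{(2)}=\{(x_1,x_2):1+ix_1+i^2x_2=0\}$, $i\in\{1,\dots,n\}$. A chamber is a connected component of the complement of the union of the lines; $\operatorname{Ch}(\mathcal H_n^{(2)})$ is the set of chambers. The sign word of a chamber $C$ is $\sigma(C)=\sigma_1\cdots\sigma_n\in\{+,-\}^n$ with $\sigma_i=\operatorname{sgn}(1+ix_1+i^2x_2)$ for any $(x_1,x_2)\in C$. If $\sigma(C)$ is all plus, set $r(C)=t(C)=0$. Otherwise $\sigma(C)$ is uniquely of the form ${+}^{\,t(C)}\,{-}^{\,r(C)}\,{+}^{\,n-r(C)-t(C)}$ with $r(C)\ge1$, $t(C)\ge 0$; this defines $r(C),t(C)$. For words, $|w|_{\mathtt a}$ is the number of letters $\mathtt a$ in $w$ and $\binom{w}{\mathtt{ab}}$ is the number of occurrences of $\mathtt{ab}$ as a scattered subword of $w$. Set $\operatorname{strip}(w)=\lfloor\binom{w}{\mathtt{ab}}/|w|_{\mathtt a}\rfloor$ if $|w|_{\mathtt a}>0$ and $\operatorname{strip}(w)=0$ if $|w|_{\mathtt a}=0$.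 For $u,w\in\{\mathtt a,\mathtt b\}^n$, $u\sim_{3/2}w$ means $|u|_{\mathtt a}=|w|_{\mathtt a}$ and $\operatorname{strip}(u)=\operatorname{strip}(w)$; $[w]_{\sim_{3/2}}$ is the class of $w$ in $\{\mathtt a,\mathtt b\}^n$. *)

(* Defs.v *)
From HB Require Import structures.
From mathcomp Require Import all_boot all_order all_algebra generic_quotient.
From mathcomp Require Import all_classical all_reals all_analysis.
From mathcomp Require Import zify ring lra.

Set Implicit Arguments.
Unset Strict Implicit.
Unset Printing Implicit Defensive.

Import Order.TTheory GRing.Theory Num.Theory.
Import numFieldNormedType.Exports.

Local Open Scope classical_set_scope.
Local Open Scope ring_scope.
Local Open Scope quotient_scope.

Section Arrangement.
Variable R : realType.
Implicit Types (n i : nat) (x : R * R) (C : set (R * R)).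

Definition line_form i x : R := 1 + i%:R * x.1 + i%:R ^+ 2 * x.2.

Definition line i : set (R * R) := [set x | line_form i x = 0].

Definition line_complement n : set (R * R) :=
  ~` \bigcup_(i in [set i | (1 <= i <= n)%N]) line i.

Definition chambers n : set (set (R * R)) :=
  [set C | exists2 x, line_complement n x
                    & C = connected_component (line_complement n) x].

(* The letters + and - are encoded by the integers 1 and -1; the line of index
   i.+1 occupies position i of the word. *)
Definition sign_word_at n x : n.-tuple int :=
  [tuple sgz (line_form i.+1 x) | i < n].

(* The sign word is read off at a chosen point of C; by sign_wordE below the
   choice is immaterial when C is a chamber. *)
Definition sign_word n C : n.-tuple int := sign_word_at n (xget 0 C).

Definition sign_blocks n r t : seq int :=
  nseq t 1 ++ nseq r (-1) ++ nseq (n - r - t) 1.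

(* The pair (r(C), t(C)). No pair with r >= 1 qualifies when the sign word is
   all plus, which gives (0, 0); otherwise the pair exists and is unique, see
   rtP and sign_blocks_inj below. *)
Definition rt n C : 'I_n.+1 * 'I_n.+1 :=
  odflt (ord0, ord0)
    [pick p : 'I_n.+1 * 'I_n.+1 |
       (1 <= p.1)%N && (sign_word n C == sign_blocks n p.1 p.2 :> seq int)].

Definition chamber_r n C : nat := (rt n C).1.
Definition chamber_t n C : nat := (rt n C).2.

Lemma rt_leq n C : (chamber_r n C + chamber_t n C <= n)%N.
Proof.
rewrite /chamber_r /chamber_t /rt; case: pickP => [[r t] /= /andP[_ /eqP e]|//].
by have := congr1 size e; rewrite size_tuple ?card_ord !size_cat !size_nseq; lia.
Qed.

Lemma chamber_nonempty n C : chambers n C -> C !=set0.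
Proof. by move=> [x Ax ->]; exists x; exact: connected_component_refl. Qed.

Lemma continuous_line_form i : continuous (line_form i).
Proof.
move=> x; apply: cvgD; first apply: cvgD; first exact: cvg_cst.
- by apply: cvgM; [exact: cvg_cst|exact: cvg_fst].
- by apply: cvgM; [exact: cvg_cst|exact: cvg_snd].
Qed.

Lemma sign_word_at_chamber n C x y :
  chambers n C -> C x -> C y -> sign_word_at n x = sign_word_at n y.
Proof.
move=> [z Az ->] Cx Cy; apply: eq_from_tnth => i; rewrite !tnth_mktuple.
set C' := connected_component _ _ in Cx Cy.
have img : is_interval (line_form i.+1 @` C').
  apply/connected_intervalP/connected_continuous_connected.
    exact: component_connected.
  exact/continuous_subspaceT/continuous_line_form.
have n0 w : C' w -> line_form i.+1 w != 0.
  move=> /connected_component_sub Aw; apply/eqP => w0.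
  by apply: Aw; exists i.+1 => /=; first exact: ltn_ord.
have im w : C' w -> (line_form i.+1 @` C') (line_form i.+1 w) by exists w.
have h v w : C' v -> C' w -> line_form i.+1 v < 0 -> ~ 0 < line_form i.+1 w.
  move=> Cv Cw v0 w0.
  have v0w : line_form i.+1 v <= 0 <= line_form i.+1 w by rewrite !ltW.
  have [u /n0 /eqP + u0] := img _ _ (im _ Cv) (im _ Cw) 0 v0w.
  by rewrite u0.
case: (ltgtP (line_form i.+1 x) 0) (n0 _ Cx) => // hx _;
  case: (ltgtP (line_form i.+1 y) 0) (n0 _ Cy) => // hy _.
- by rewrite !ltr0_sgz.
- by case: (h _ _ Cx Cy hx hy).
- by case: (h _ _ Cy Cx hy hx).
- by rewrite !gtr0_sgz.
Qed.

Lemma sign_wordE n C x : chambers n C -> C x -> sign_word n C = sign_word_at n x.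
Proof.
move=> chC Cx; apply: (sign_word_at_chamber chC) => //.
by case: xgetP => // /(_ x).
Qed.

Lemma line_form_lt0_between i k j x : (0 < i)%N -> (i <= k <= j)%N ->
  line_form i x < 0 -> line_form j x < 0 -> line_form k x < 0.
Proof.
move=> i0 /andP[ik kj] fi fj.
have [<-//|nik] := eqVneq i k; have [->//|nkj] := eqVneq k j.
have ik' : (i%:R : R) < k%:R by rewrite ltr_nat ltn_neqAle nik.
have kj' : (k%:R : R) < j%:R by rewrite ltr_nat ltn_neqAle nkj.
have i0' : (0 : R) < i%:R by rewrite ltr0n.
have := fi; have := fj; rewrite ltNge [in X in _ -> X]ltNge.
case: (ltP (line_form k x) 0) => // fk _ _.
have E : (j%:R - i%:R) * (k%:R - i%:R) * (j%:R - k%:R)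
  + k%:R * j%:R * (j%:R - k%:R) * (- line_form i x)
  + i%:R * k%:R * (k%:R - i%:R) * (- line_form j x)
  + i%:R * j%:R * (j%:R - i%:R) * line_form k x = 0.
  by rewrite /line_form; ring.
suff : (0 : R) < 0 by rewrite ltxx.
rewrite -{2}E.
apply: ltr_wpDr; first by rewrite !mulr_ge0//; lra.
by rewrite !addr_gt0// !mulr_gt0//; lra.
Qed.

Lemma rtP n C : chambers n C ->
  if sign_word n C == nseq n 1 :> seq int
  then (chamber_r n C = 0%N) /\ (chamber_t n C = 0%N)
  else (1 <= chamber_r n C)%N /\
       tval (sign_word n C) = sign_blocks n (chamber_r n C) (chamber_t n C).
Proof.
move=> chC; have [x Cx] := chamber_nonempty chC.
have sE := sign_wordE chC Cx.
have nz k : (k < n)%N -> line_form k.+1 x != 0.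
  move=> kn; apply/eqP => f0; case: chC Cx => y _ -> /connected_component_sub.
  by apply; exists k.+1.
have sk k : (k < n)%N -> nth 0 (sign_word n C) k = sgz (line_form k.+1 x).
  by move=> kn; rewrite sE -(tnth_nth 0 _ (Ordinal kn)) tnth_mktuple.
pose P k := (k < n)%N && (line_form k.+1 x < 0).
rewrite /chamber_r /chamber_t /rt; case: pickP => [[r t] /= /andP[r0 /eqP e]|H].
  rewrite ifN//; apply/eqP; rewrite e => e1.
  have : (-1 : int) \in nseq n 1 by rewrite -e1 !mem_cat !mem_nseq r0 eqxx orbT.
  by rewrite mem_nseq andbF.
case: eqP => // nall.
have [[k Pk]|noP] := pselect (exists k, P k); last first.
  case: nall; apply: (@eq_from_nth _ 0); rewrite size_tuple ?size_nseq// => k kn.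
  rewrite sk// nth_nseq kn gtr0_sgz// lt0r nz//= leNgt.
  by apply/negP => fk; apply: noP; exists k; rewrite /P kn.
exfalso.
have exP : exists k, P k by exists k.
have ubP j : P j -> (j <= n)%N by case/andP => /ltnW.
case: (ex_minnP exP) => t Pt tmin; case: (ex_maxnP exP ubP) => m Pm mmax.
have tm := tmin _ Pm; have /andP[tn ft] := Pt; have /andP[mn fm] := Pm.
have rn : ((m - t).+1 < n.+1)%N by lia.
have tn' : (t < n.+1)%N by lia.
have /negbT/negP := H (Ordinal rn, Ordinal tn'); apply => /=; apply/eqP.
apply: (@eq_from_nth _ 0).
  by rewrite size_tuple ?card_ord !size_cat !size_nseq; lia.
move=> i; rewrite size_tuple ?card_ord => iltn; rewrite sk// !nth_cat !size_nseq !nth_nseq.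
have pos : ~~ P i -> sgz (line_form i.+1 x) = 1.
  by rewrite /P iltn/= -leNgt => f0; rewrite gtr0_sgz// lt0r nz.
case: ifPn => it; first by rewrite it pos //; apply/negP => /tmin; lia.
case: ifPn => im; rewrite ?im.
  by rewrite ltr0_sgz//; apply: (line_form_lt0_between _ _ ft fm) => //; lia.
rewrite pos; last by apply/negP => /mmax; lia.
by rewrite ifT//; lia.
Qed.

Lemma sign_blocks_inj n r t r' t' : (1 <= r)%N -> (1 <= r')%N ->
  (r + t <= n)%N -> (r' + t' <= n)%N ->
  sign_blocks n r t = sign_blocks n r' t' -> r = r' /\ t = t'.
Proof.
move=> r0 r'0 rt rt' e.
have fE u v : (1 <= u)%N -> find (pred1 (-1)) (sign_blocks n u v) = v.
  case: u => // u _; rewrite /sign_blocks find_cat has_nseq andbF size_nseq.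
  by rewrite /= addn0.
have cE u v : count (pred1 (-1)) (sign_blocks n u v) = u.
  by rewrite /sign_blocks !count_cat !count_nseq /= mul0n mul1n mul0n addn0.
by split; [rewrite -(cE r t) e cE|rewrite -(fE r t)// e fE].
Qed.

End Arrangement.

Arguments chambers R n : clear implicits.

Inductive letter := La | Lb.

Definition is_La (x : letter) : bool := if x is La then true else false.

Lemma is_LaK : cancel is_La (fun c : bool => if c then La else Lb).
Proof. by case. Qed.

HB.instance Definition _ := Countable.copy letter (can_type is_LaK).

Section Words.
Variable n : nat.
Implicit Types u w : n.-tuple letter.

Definition count_a w : nat := count_mem La w.

Definition count_ab w : nat :=
  #|[pred p : 'I_n * 'I_n |
      [&& (p.1 < p.2)%N, tnth w p.1 == La & tnth w p.2 == Lb]]|.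

Definition strip w : nat :=
  if (0 < count_a w)%N then (count_ab w %/ count_a w)%N else 0%N.

Definition equiv32 u w : bool :=
  (count_a u == count_a w) && (strip u == strip w).

Lemma equiv32_is_equiv : equiv_class_of equiv32.
Proof.
split=> [w|u w|v u w].
- by rewrite /equiv32 !eqxx.
- by rewrite /equiv32 ![count_a u == _]eq_sym ![strip u == _]eq_sym.
- by move=> /andP[/eqP h1 /eqP h2]; rewrite /equiv32 h1 h2.
Qed.

Canonical equiv32_equiv := EquivRelPack equiv32_is_equiv.

Definition words_mod := {eq_quot equiv32}.

End Words.

Definition chamber_letters (R : realType) n (C : set (R * R)) : seq letter :=
  let r := chamber_r n C in
  let t := chamber_t n C in
  nseq (n - r - t) Lb ++ nseq r La ++ nseq t Lb.

Lemma size_chamber_letters (R : realType) n (C : set (R * R)) :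
  size (chamber_letters n C) == n.
Proof.
by rewrite !size_cat !size_nseq; apply/eqP; have := rt_leq n C; lia.
Qed.

Definition chamber_word (R : realType) n (C : set (R * R)) : n.-tuple letter :=
  Tuple (size_chamber_letters n C).

(* The set chambers R n is coerced to the type of its elements. *)
Definition Psi (R : realType) n (C : chambers R n) : words_mod n :=
  \pi_(words_mod n) (chamber_word n (\val C)).

(* Main.v *)
Require Import Defs.
From mathcomp Require Import all_boot all_order all_algebra.
From mathcomp Require Import all_classical all_reals all_analysis.
From mathcomp Require Import generic_quotient zify ring lra.

(** The pair (r(C), t(C)) is a complete invariant on both sides. A set of
    points with a given sign word is convex, hence lies in a single chamber, and
    the pair (r, t) with r >= 1 is realised by the parabola with value 1 at 0
    and with roots t + 1/2 and t + r + 1/2. On the side of words,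
    b^(n-r-t) a^r b^t has r letters a and r * t subwords ab, so its strip is t;
    conversely a word with r >= 1 letters a has at most r * (n - r) subwords ab,
    so its strip is at most n - r. *)

Set Implicit Arguments.
Unset Strict Implicit.
Unset Printing Implicit Defensive.

Import Order.TTheory GRing.Theory Num.Theory.
Import numFieldNormedType.Exports.

Local Open Scope classical_set_scope.
Local Open Scope ring_scope.
Local Open Scope quotient_scope.

Lemma inj_surj_bijective (S T : Type) (f : S -> T) :
  injective f -> (forall y, exists x, f x = y) -> bijective f.
Proof.
move=> f_inj f_surj; have [g fg] := choice f_surj.
by exists g => // x; apply: f_inj.
Qed.

(** * Chambers, sign words and realisation of pairs (r, t) *)

Section Chambers.
Variable R : realType.
Implicit Types (n : nat) (x y : R * R) (C D : set (R * R)).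

Lemma continuous_segment x y :
  continuous (fun l : R => (x.1 + l * (y.1 - x.1), x.2 + l * (y.2 - x.2))).
Proof.
have affine (a b : R) : continuous (fun l : R => a + l * b).
  move=> l; apply: cvgD; first exact: cvg_cst.
  by apply: cvgM; [exact: cvg_id|exact: cvg_cst].
by move=> l; exact: (cvg_pair (affine _ _ l) (affine _ _ l)).
Qed.

Lemma sgz_convex (a b l : R) : 0 <= l <= 1 -> a != 0 -> sgz a = sgz b ->
  a + l * (b - a) != 0.
Proof.
move=> /andP[l0 l1] a0 ab.
have -> : a + l * (b - a) = (1 - l) * a + l * b by ring.
case: (ltgtP a 0) a0 ab => // ha _.
  rewrite ltr0_sgz// => /esym/eqP; rewrite sgz_cp0 => hb.
  by apply/eqP; nra.
rewrite gtr0_sgz// => /esym/eqP; rewrite sgz_cp0 => hb.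
by apply/eqP; nra.
Qed.

Lemma line_complementP n x :
  line_complement n x <-> forall i : 'I_n, line_form i.+1 x != 0.
Proof.
split=> [Ax i|h [[//|i] /= ilt]]; last exact/eqP/(h (Ordinal ilt)).
by apply/eqP => fi; apply: Ax; exists i.+1 => //=; exact: ltn_ord.
Qed.

(** Each [line_form] is affine along the segment from [x] to [y], so by [sgz_convex] the segment
    avoids every line; it is a connected subset of the complement joining the two points. *)
Lemma sign_word_at_component n x y : line_complement n x ->
  sign_word_at n x = sign_word_at n y ->
  connected_component (line_complement n) x y.
Proof.
move=> Ax xy.
pose g (l : R) := (x.1 + l * (y.1 - x.1), x.2 + l * (y.2 - x.2)).
have g0 : g 0 = x by rewrite /g !mul0r !addr0; case: (x).
have g1 : g 1 = y by rewrite /g !mul1r !subrKC; case: (y).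
exists (g @` `[0, 1]).
  split.
  - by exists 0 => //=; rewrite in_itv /= lexx ler01.
  - move=> _ [l /= l01 <-]; apply/line_complementP => i.
    have -> : line_form i.+1 (g l) = line_form i.+1 x
        + l * (line_form i.+1 y - line_form i.+1 x).
      by rewrite /line_form /g /=; ring.
    apply: sgz_convex; first by rewrite in_itv in l01.
    + by move/line_complementP: Ax.
    + by have := congr1 (fun w => tnth w i) xy; rewrite !tnth_mktuple.
  - apply: connected_continuous_connected.
      exact/connected_intervalP/interval_is_interval.
    exact/continuous_subspaceT/continuous_segment.
by exists 1 => //=; rewrite in_itv /= lexx ler01.
Qed.

Lemma sign_word_inj n C D : chambers R n C -> chambers R n D ->
  sign_word n C = sign_word n D -> C = D.
Proof.
move=> chC chD.
have [[x Ax Cx] [y Ay Dy]] := (chC, chD).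
have xC : C x by rewrite Cx; exact: connected_component_refl.
have yD : D y by rewrite Dy; exact: connected_component_refl.
rewrite (sign_wordE chC xC) (sign_wordE chD yD) => xy.
by rewrite Cx Dy; apply/same_connected_component/sign_word_at_component.
Qed.

Lemma chamber_r0 n C : chambers R n C -> chamber_r n C = 0%N ->
  chamber_t n C = 0%N.
Proof. by move=> /rtP; case: eqP => [_ []//|_ [+ _ r0]]; rewrite r0. Qed.

(** The default r = t = 0 gives a block word that is all plus, so one formula covers both cases of
    [rtP]. *)
Lemma sign_word_rt n C : chambers R n C ->
  tval (sign_word n C) = sign_blocks n (chamber_r n C) (chamber_t n C).
Proof.
move=> /rtP; case: eqP => [-> [-> ->]|_ []//].
by rewrite /sign_blocks /= !subn0.
Qed.

Lemma rt_inj n C D : chambers R n C -> chambers R n D ->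
  chamber_r n C = chamber_r n D -> chamber_t n C = chamber_t n D -> C = D.
Proof.
move=> chC chD r_eq t_eq; apply: (sign_word_inj chC chD); apply: val_inj => /=.
by rewrite !sign_word_rt// r_eq t_eq.
Qed.

Lemma nth_sign_word_at n x k : (k < n)%N ->
  nth 0 (sign_word_at n x) k = sgz (line_form k.+1 x).
Proof.
by move=> kn; rewrite -(tnth_nth 0 (sign_word_at n x) (Ordinal kn)) tnth_mktuple.
Qed.

Lemma sign_blocks_count n r t : count_mem (-1) (sign_blocks n r t) = r.
Proof. by rewrite /sign_blocks !count_cat !count_nseq /= !mul0n mul1n addn0. Qed.

(** With r = 0 the block word is all plus whenever t <= n, so it cannot determine t; hence the
    second hypothesis. *)
Lemma chamber_exists n r t : (r + t <= n)%N -> (r = 0%N -> t = 0%N) ->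
  exists C, [/\ chambers R n C, chamber_r n C = r & chamber_t n C = t].
Proof.
move=> rtn r0t0.
suff [x sx] : exists x, tval (sign_word_at n x) = sign_blocks n r t.
  (* The letters of a block word are 1 and -1, so no form vanishes at [x]. *)
  have Ax : line_complement n x.
    apply/line_complementP => i.
    have : tnth (sign_word_at n x) i \in sign_blocks n r t.
      by rewrite -sx mem_tnth.
    rewrite tnth_mktuple /sign_blocks !mem_cat !mem_nseq.
    by apply: contraTneq => ->; rewrite sgz0 !andbF.
  set C := connected_component (line_complement n) x.
  have chC : chambers R n C by exists x.
  have xC : C x by exact: connected_component_refl.
  exists C; move: (sign_word_rt chC); rewrite (sign_wordE chC xC) sx => e.
  have rE : chamber_r n C = r.
    by rewrite -(sign_blocks_count n r t) e sign_blocks_count.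
  split=> //; have [r0|r0] := posnP r.
    by rewrite r0t0//; apply: chamber_r0; rewrite ?rE.
  by have [] := sign_blocks_inj r0 _ rtn (rt_leq n C) e; rewrite ?rE.
have sizeE : n = size (sign_blocks n r t).
  by rewrite !size_cat !size_nseq; lia.
have [r0|r0] := posnP r.
  (* At the origin every form has value 1. *)
  exists 0; apply: (@eq_from_nth _ 0); rewrite size_tuple// => k kn.
  rewrite nth_sign_word_at// r0t0// r0 /sign_blocks /= !subn0 nth_nseq kn.
  by rewrite /line_form /= !mulr0 !addr0 sgz1.
(* Half-integers are never indices of lines, and the integers between these two roots are t + 1,
   ..., t + r, the indices that must get a minus sign. *)
pose a : R := t%:R + 2^-1; pose b : R := (t + r)%:R + 2^-1.
have a0 : 0 < a by rewrite ltr_wpDl// invr_gt0.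
have b0 : 0 < b by rewrite ltr_wpDl// invr_gt0.
(* These are the coefficients of (1 - z / a) (1 - z / b). *)
exists (- (a^-1 + b^-1), (a * b)^-1).
have fE i : line_form i (- (a^-1 + b^-1), (a * b)^-1) =
    (a * b)^-1 * ((i%:R - a) * (i%:R - b)).
  by rewrite /line_form /=; field; rewrite !gt_eqF.
have half (m k : nat) : sgz (k%:R - (m%:R + 2^-1) : R) = if (m < k)%N then 1 else -1.
  case: ltnP => mk.
    have : (m.+1%:R : R) <= k%:R by rewrite ler_nat.
    by rewrite -natr1 => ?; apply: gtr0_sgz; lra.
  have : (k%:R : R) <= m%:R by rewrite ler_nat.
  by move=> ?; apply: ltr0_sgz; lra.
apply: (@eq_from_nth _ 0); rewrite size_tuple// => k kn.
rewrite nth_sign_word_at// fE !sgzM.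
rewrite (gtr0_sgz (x := _^-1)) ?invr_gt0 ?mulr_gt0// mul1r /a /b !half.
rewrite !nth_cat !size_nseq !nth_nseq.
by repeat case: ifP; lia.
Qed.

End Chambers.

(** * Letter counts and strips of words *)

Section Words.
Variable n : nat.
Implicit Types w : n.-tuple letter.

Lemma card_tnth w (x : letter) :
  #|[pred i : 'I_n | tnth w i == x]| = count_mem x w.
Proof.
rewrite cardE /enum_mem size_filter -enumT.
by rewrite [in RHS](tuple_map_ord w) /= count_map.
Qed.

Lemma count_a_leq w : (count_a w <= n)%N.
Proof. by have := count_size (pred1 La) w; rewrite size_tuple. Qed.

Lemma count_b w : count_mem Lb w = (n - count_a w)%N.
Proof.
have := count_predC (pred1 La) w; rewrite size_tuple -/(count_a w).
rewrite (@eq_count _ (predC _) (pred1 Lb)) => [nE|[]//].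
by apply/esym/eqP; rewrite -(eqn_add2l (count_a w)) subnKC ?count_a_leq// nE.
Qed.

(** An occurrence of ab is in particular a pair formed by a position of a and a position of b. *)
Lemma count_ab_leq w : (count_ab w <= count_a w * (n - count_a w))%N.
Proof.
rewrite -count_b /count_a -!card_tnth -cardX.
by apply/subset_leq_card/fintype.subsetP => -[i j] /and3P[_ wi wj]; apply/andP.
Qed.

(** This makes the letter count and strip of any word an admissible pair for [chamber_exists]. *)
Lemma strip_leq w : (count_a w + strip w <= n)%N.
Proof.
rewrite /strip; case: posnP => [->//|a0].
rewrite -leq_subRL ?count_a_leq//.
by rewrite -(mulKn (n - _) a0) leq_div2r// count_ab_leq.
Qed.

Lemma card_ord_geq m : #|[pred j : 'I_n | (m <= j)%N]| = (n - m)%N.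
Proof.
rewrite -sum1_card -(big_geq_mkord _ _ predT (fun=> 1%N)).
by rewrite sum_nat_const_nat muln1.
Qed.

Lemma count_a_blocks w r t : tval w = nseq (n - r - t) Lb ++ nseq r La ++ nseq t Lb ->
  count_a w = r.
Proof. by move=> we; rewrite /count_a we !count_cat !count_nseq /= mul1n !mul0n addn0. Qed.

Lemma strip_blocks w r t : (0 < r)%N -> (r + t <= n)%N ->
  tval w = nseq (n - r - t) Lb ++ nseq r La ++ nseq t Lb -> strip w = t.
Proof.
move=> r0 rtn we; have aE := count_a_blocks we.
suff abE : count_ab w = (r * t)%N by rewrite /strip abE aE r0 mulKn.
have wE (i : 'I_n) : (tnth w i == La) = (n - r - t <= i < n - t)%N.
  have ba : (Lb == La) = false by [].
  have := ltn_ord i; rewrite (tnth_nth La) we !nth_cat !size_nseq !nth_nseq.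
  by repeat case: ifP; rewrite ?eqxx ?ba; lia.
have bE (i : 'I_n) : (tnth w i == Lb) = ~~ (tnth w i == La) by case: (tnth w i).
have tE : (n - (n - t))%N = t by lia.
(* The first block of b precedes every a, so the occurrences of ab are exactly the pairs of a
   position of a and one of the last t positions. *)
rewrite -{1}aE -tE -card_ord_geq /count_a -card_tnth -cardX.
apply: eq_card => -[i j]; rewrite !inE /= bE !wE.
by have := ltn_ord i; have := ltn_ord j; lia.
Qed.

End Words.

Lemma count_a_chamber_word (R : realType) n (C : set (R * R)) :
  count_a (chamber_word n C) = chamber_r n C.
Proof. exact: count_a_blocks. Qed.

Lemma strip_chamber_word (R : realType) n (C : set (R * R)) :
  chambers R n C -> strip (chamber_word n C) = chamber_t n C.
Proof.
move=> chC; have [r0|r0] := posnP (chamber_r n C).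
  by rewrite /strip count_a_chamber_word r0 chamber_r0.
by apply: (strip_blocks r0) => //; exact: rt_leq.
Qed.

Theorem proposition9 (R : realType) (n : nat) (hn : (1 <= n)%N) :
  bijective (@Psi R n).
Proof.
apply: inj_surj_bijective => [C D /eqmodP /andP[/eqP + /eqP]|q].
  have [chC chD] := (set_valP C, set_valP D).
  rewrite !count_a_chamber_word !strip_chamber_word// => r_eq t_eq.
  exact/val_inj/(rt_inj chC chD).
(* The count and strip of any representative determine the class, so a chamber with r and t equal to
   them is a preimage. *)
pose w := repr q.
have w0 : count_a w = 0%N -> strip w = 0%N by rewrite /strip => ->.
have [C [chC rC tC]] := @chamber_exists R _ _ _ (strip_leq w) w0.
exists (SigSub (mem_set chC)); rewrite -[RHS]reprK; apply/eqmodP/andP => /=.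
by rewrite count_a_chamber_word strip_chamber_word// rC tC.
Qed.
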